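(* For the concurrent graph sharing game, \[ \inf_{(G,w)} v(G,w) = \tfrac{1}{3} \qquad\text{and}\qquad \inf_{(G,w),\ G \text{ is a tree}} v(G,w) = \tfrac{1}{2}, \] where the first infimum ranges over all instances $(G,w)$ and the second over all instances $(G,w)$ in which $G$ is a tree.
   Context: An instance of the concurrent graph sharing game is a pair $(G,w)$ where $G=(V,E)$ is a finite connected graph and $w:V\to(0,1]$ is a positive vertex-weight function with $\sum_{v\in V} w(v)=1$; for $A\subseteq V$ write $w(A)=\sum_{a\in A}w(a)$. It is assumed throughout that no two distinct subsets of vertices have the same total weight, so ties never occur. The game is played by two players, 1st and 2nd. 1st begins by taking any vertex. In each subsequent round, the player whose sum of weights of vertices taken so far is smaller takes a not-yet-taken vertex adjacent to some already taken vertex (so the set of all taken vertices is always connected, and exactly one new vertex is taken per round); the game ends when all vertices are taken. For a vertex $a$, let $F_a$ and $S_a$ be the sets of vertices taken by 1st and 2nd, respectively, when 1st starts with $a$ and from then on 1st plays to maximize $w(F_a)$ and 2nd plays to maximize $w(S_a)$. The value of the instance is $v(G,w)=\max_{a\in V} w(F_a)$, the maximum total weight 1st can guarantee to take. *)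

(* Defs.v *)
From HB Require Import structures.
From mathcomp Require Import all_boot all_order all_algebra.
From mathcomp Require Import reals.

Set Implicit Arguments.
Unset Strict Implicit.
Unset Printing Implicit Defensive.

Import Order.TTheory GRing.Theory Num.Theory.
Local Open Scope ring_scope.

Section ConcurrentGraphSharing.

Variable R : realType.
Variable T : finType.

Definition wsum (w : T -> R) (A : {set T}) : R := \sum_(a in A) w a.

Definition is_instance (e : rel T) (w : T -> R) : Prop :=
  (forall x y, e x y = e y x) /\
  (forall x, ~~ e x x) /\
  (forall x y, connect e x y) /\
  (forall v, 0 < w v <= 1) /\
  wsum w setT = 1 /\
  (forall A B : {set T}, A != B -> wsum w A != wsum w B).

Definition has_cycle (e : rel T) : Prop :=
  exists (x : T) (p : seq T),
    [/\ path e x p, uniq (x :: p), (2 <= size p)%N & e (last x p) x].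

Definition is_tree (e : rel T) : Prop :=
  (forall x y, connect e x y) /\ ~ has_cycle e.

Definition available (e : rel T) (F S : {set T}) : {set T} :=
  [set v | (v \notin F :|: S) && [exists u in F :|: S, e u v]].

Definition seqmax (d : R) (s : seq R) : R :=
  if s is x :: s' then foldr Num.max x s' else d.
Definition seqmin (d : R) (s : seq R) : R :=
  if s is x :: s' then foldr Num.min x s' else d.

(* gval e w n F S: the final total weight of 1st under optimal play (1st
   maximizing w(F), 2nd maximizing w(S), equivalently minimizing w(F) since
   w(F)+w(S)=1 at the end) from the position where 1st holds F and 2nd holds S;
   n is fuel (number of remaining moves allowed, #|T| suffices).  The player
   with the smaller total weight moves (ties cannot occur after the first move). *)
Fixpoint gval (e : rel T) (w : T -> R) (n : nat) (F S : {set T}) : R :=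
  match n with
  | 0 => wsum w F
  | n'.+1 =>
    if F :|: S == setT then wsum w F
    else
      let A := enum (available e F S) in
      if wsum w F < wsum w S
      then seqmax (wsum w F) [seq gval e w n' (v |: F) S | v <- A]
      else seqmin (wsum w F) [seq gval e w n' F (v |: S) | v <- A]
  end.

Definition first_value (e : rel T) (w : T -> R) (a : T) : R :=
  gval e w #|T| [set a] set0.

Definition game_value (e : rel T) (w : T -> R) : R :=
  seqmax 0 [seq first_value e w a | a <- enum T].

End ConcurrentGraphSharing.

(* Main.v *)
(** Each move is made by the player who is behind, so the lead never exceeds the
    largest vertex weight: 1st gets 1/3 by taking a vertex of weight at least 1/3
    if there is one, and by playing arbitrarily otherwise.

    The position where 1st holds [F] and 2nd holds [S] is worth to 1st what the
    swapped position is worth to 2nd.  If every start lost for 1st, each vertex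
    would have a good reply at one of its neighbours; in a tree following replies
    ends in an edge [a b] whose ends are good replies to each other, so that
    both [{a}, {b}] and [{b}, {a}] lose for 1st, although their values sum to 1.

    For the converse bounds, take a 7-cycle with three vertices of weight close to
    1/3 and four light ones, on which 2nd can always take two of the three, and
    a single edge with weights close to 1/2. *)
Require Import Defs.
From HB Require Import structures.
From mathcomp Require Import all_boot all_order all_algebra.
From mathcomp Require Import reals.
From mathcomp Require Import lra zify.
Import Order.TTheory GRing.Theory Num.Theory.
Local Open Scope ring_scope.

(** * Maxima and minima of lists *)

Section SeqExtrema.
Context {R : realType}.
Implicit Types (d b x : R) (s : seq R).

Lemma seqmax_ge d s x : x \in s -> x <= seqmax d s.
Proof.
case: s => // y s; rewrite inE /= => xs.
elim: s xs => [|z s IHs] /=; first by rewrite orbF => /eqP->.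
by rewrite inE le_max orbCA => /orP[/eqP->|/IHs->]; rewrite ?lexx ?orbT.
Qed.

Lemma seqmin_le d s x : x \in s -> seqmin d s <= x.
Proof.
case: s => // y s; rewrite inE /= => xs.
elim: s xs => [|z s IHs] /=; first by rewrite orbF => /eqP->.
by rewrite inE ge_min orbCA => /orP[/eqP->|/IHs->]; rewrite ?lexx ?orbT.
Qed.

Lemma seqmax_mem d s : s != [::] -> seqmax d s \in s.
Proof.
case: s => // y s _ /=; elim: s => [|z s] /=; first exact: mem_head.
rewrite !inE maxEle => /orP[/eqP->|IHs]; case: ifP => _; rewrite ?eqxx ?orbT //.
by rewrite IHs !orbT.
Qed.

Lemma seqmin_mem d s : s != [::] -> seqmin d s \in s.
Proof.
case: s => // y s _ /=; elim: s => [|z s] /=; first exact: mem_head.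
rewrite !inE minEle => /orP[/eqP->|IHs]; case: ifP => _; rewrite ?eqxx ?orbT //.
by rewrite IHs !orbT.
Qed.

Lemma seqmax_le_bound d s b :
  d <= b -> {in s, forall x, x <= b} -> seqmax d s <= b.
Proof.
case: (eqVneq s [::]) => [->|s0] // _ sb.
exact/sb/seqmax_mem.
Qed.

Lemma seqmax_attained {T : finType} (A : {set T}) (f : T -> R) d :
  A != set0 -> exists2 v, v \in A & seqmax d [seq f v | v <- enum A] = f v.
Proof.
move=> A0; have s0: [seq f v | v <- enum A] != [::].
  by rewrite -size_eq0 size_map -cardE cards_eq0.
by have /mapP[v] := seqmax_mem d _ s0; rewrite mem_enum => vA ->; exists v.
Qed.

Lemma seqmin_attained {T : finType} (A : {set T}) (f : T -> R) d :
  A != set0 -> exists2 v, v \in A & seqmin d [seq f v | v <- enum A] = f v.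
Proof.
move=> A0; have s0: [seq f v | v <- enum A] != [::].
  by rewrite -size_eq0 size_map -cardE cards_eq0.
by have /mapP[v] := seqmin_mem d _ s0; rewrite mem_enum => vA ->; exists v.
Qed.

(** The two defaults may be unrelated because a nonempty list never consults them. *)
Lemma seqmin_compl d d' s :
  s != [::] -> seqmin d [seq 1 - x | x <- s] = 1 - seqmax d' s.
Proof.
case: s => // y s _ /=; elim: s => //= z s ->.
by rewrite oppr_max addr_minr.
Qed.

End SeqExtrema.

(** * Periodic points of self-maps along edges *)

(** The hypothesis covers every point and not only [y]: a repetition in the orbit gives a short
    period to the repeated point, which may lie further along. *)
Lemma min_period_traject_uniq {T : eqType} (r : T -> T) (y : T) (k : nat) :
    (forall i x, (0 < i < k)%N -> iter i r x != x) -> uniq (traject r y k).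
Proof.
case: k => // m period_min; rewrite looping_uniq; apply/negP => /trajectP[i ltim].
rewrite -[X in iter X](subnK (ltnW ltim)) iterD; apply/eqP/period_min.
by rewrite subn_gt0 ltim ltnS leq_subr.
Qed.

Lemma acyclic_selfmap_two_cycle {T : finType} (e : rel T) (r : T -> T) (x0 : T) :
    (forall x, ~~ e x x) -> ~ has_cycle e -> (forall x, e x (r x)) ->
  exists x, r (r x) = x.
Proof.
move=> e_irr e_acyclic er.
have: exists k, (0 < k)%N && [exists y, iter k r y == y].
  have := looping_order r x0 => /trajectP[i lti eq_i].
  exists (order r x0 - i)%N; rewrite subn_gt0 lti; apply/existsP.
  by exists (iter i r x0); rewrite -iterD subnK ?eq_i // ltnW.
case/ex_minnP => k /andP[k_gt0 /existsP[y /eqP yk]] k_min.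
have uniq_y: uniq (traject r y k).
  apply: min_period_traject_uniq => i x /andP[i_gt0]; apply: contraTneq => ix.
  by rewrite -leqNgt k_min // i_gt0; apply/existsP; exists x; rewrite ix.
(* Here [k] is the least period of any point. Period 1 would be a loop, period 2 is the goal, and a
   longer one would make the orbit of [y] a cycle of the graph. *)
case: k yk k_min uniq_y k_gt0 => [|[|[|k]]] //= yk k_min uniq_y _.
- by have := er y; rewrite yk (negPf (e_irr y)).
- by exists y.
case: e_acyclic; exists y, (traject r (r y) k.+2); split=> //.
- by apply: sub_path (fpath_traject r y k.+2) => a b /= /eqP <-.
by rewrite last_traject -[X in e _ X]yk; apply: er.
Qed.

(** * Positions, moves and their values *)

Section Game.
Context {R : realType} {T : finType}.
Variables (e : rel T) (w : T -> R).
Implicit Types (F S : {set T}) (a v : T).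

Lemma wsumU1 v F : v \notin F -> wsum w (v |: F) = w v + wsum w F.
Proof. exact: big_setU1. Qed.

Lemma wsum1 v : wsum w [set v] = w v.
Proof. exact: big_set1. Qed.

Lemma wsum0 : wsum w set0 = 0.
Proof. exact: big_set0. Qed.

Lemma wsumU F S : [disjoint F & S] -> wsum w (F :|: S) = wsum w F + wsum w S.
Proof.
by move=> dFS; rewrite /wsum -bigU //; apply: eq_bigl => v; rewrite !inE.
Qed.

Lemma availableC F S : available e F S = available e S F.
Proof. by rewrite /available setUC. Qed.

Lemma available_notin F S v :
  v \in available e F S -> v \notin F /\ v \notin S.
Proof. by rewrite inE in_setU negb_or => /andP[/andP[]]. Qed.

(** If no move existed, the taken set would be closed under adjacency, hence everything by
    connectedness. *)
Lemma available_neq0 F S :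
    symmetric e -> (forall x y, connect e x y) ->
  F :|: S != set0 -> F :|: S != setT -> available e F S != set0.
Proof.
move=> e_sym e_conn /set0Pn[x xU]; apply: contraNneq => av0.
have e_closed: closed e (F :|: S).
  apply: intro_closed => [|y z eyz yU]; first exact: sym_connect_sym.
  apply: contraT => zU; move/setP/(_ z): av0.
  by rewrite !inE -in_setU zU => /existsP[]; exists y; rewrite yU.
by apply/eqP/setP => y; rewrite in_setT -(closed_connect e_closed (e_conn x y)).
Qed.

Lemma gvalS n F S : F :|: S != setT ->
  gval e w n.+1 F S =
    if wsum w F < wsum w S
    then seqmax (wsum w F)
           [seq gval e w n (v |: F) S | v <- enum (available e F S)]
    else seqmin (wsum w F)
           [seq gval e w n F (v |: S) | v <- enum (available e F S)].
Proof. by move=> /negPf /= ->. Qed.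

Lemma gval_full n F S : F :|: S = setT -> gval e w n F S = wsum w F.
Proof. by case: n => //= n ->; rewrite eqxx. Qed.

(** The invariant of the inductions on fuel. A nonempty taken set guarantees a move while vertices
    remain; the last clause makes the fuel cover the remaining vertices, so that fuel 0 means a
    finished game. *)
Definition position n F S :=
  [/\ [disjoint F & S], F :|: S != set0 & (#|T| <= n + #|F :|: S|)%N].

Lemma positionC n F S : position n F S -> position n S F.
Proof. by rewrite /position disjoint_sym setUC. Qed.

Lemma position0 F S : position 0 F S -> F :|: S = setT.
Proof.
by case=> _ _ leTU; apply/eqP; rewrite eqEcard subsetT cardsT.
Qed.

Lemma position_start a : position #|T| [set a] set0.
Proof.
split; rewrite ?setU0 ?leq_addr //; last by apply/set0Pn; exists a; rewrite inE.
by rewrite -setI_eq0 setI0.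
Qed.

Lemma position_move1 n F S v :
  v \in available e F S -> position n.+1 F S -> position n (v |: F) S.
Proof.
move=> /available_notin[vF vS] [dFS _ leTU]; split.
- by rewrite -setI_eq0 setIUl (disjoint_setI0 dFS) setU0 setI_eq0 disjoints1.
- by apply/set0Pn; exists v; rewrite !inE eqxx.
- by rewrite -setUA cardsU1 in_setU negb_or vF vS addnA addn1.
Qed.

Lemma position_move2 n F S v :
  v \in available e F S -> position n.+1 F S -> position n F (v |: S).
Proof.
by rewrite availableC => av /positionC /(position_move1 _ _ _ _ av) /positionC.
Qed.

(** * Bounds valid for every instance *)

Hypothesis inst : is_instance e w.

Let e_sym : symmetric e. Proof. by case: inst. Qed.
Let e_irr x : ~~ e x x. Proof. by case: inst => _ []. Qed.
Let e_conn x y : connect e x y. Proof. by case: inst => _ [_ []]. Qed.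
Let w_gt0 v : 0 < w v.
Proof. by case: inst => _ [_ [_ [/(_ v)/andP[]]]]. Qed.
Let wT : wsum w setT = 1. Proof. by case: inst => _ [_ [_ [_ []]]]. Qed.
Let w_inj (A B : {set T}) : A != B -> wsum w A != wsum w B.
Proof. by case: inst => _ [_ [_ [_ [_]]]]; apply. Qed.

Lemma position_full n F S :
  position n F S -> F :|: S = setT -> wsum w F + wsum w S = 1.
Proof. by case=> dFS _ _ UT; rewrite -wsumU // UT. Qed.

Lemma position_available n F S :
  position n F S -> F :|: S != setT -> available e F S != set0.
Proof. by case=> _ U0 _ UT; apply: available_neq0. Qed.

(** Swapping the holdings leaves the same set behind, with the same moves, but its owner now
    minimizes where it maximized; by induction each option [x] becomes [1 - x]. *)
Lemma gval_compl n F S :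
  position n F S -> gval e w n F S + gval e w n S F = 1.
Proof.
elim: n F S => [|n IHn] F S pos.
  by rewrite /= (position_full _ _ _ pos) // (position0 _ _ pos).
have [UT|UT] := eqVneq (F :|: S) setT.
  by rewrite !gval_full ?(position_full _ _ _ pos) // setUC.
(* A tie must be excluded, since [gval] would let 2nd move on both sides. Disjoint sets that are not
   both empty differ, hence so do their weights. *)
wlog ltFS: F S pos UT / wsum w F < wsum w S.
  move=> IH; have FS: F != S.
    have [dFS U0 _] := pos; apply: contraNneq U0 => FS.
    by move: dFS; rewrite FS -setI_eq0 setIid setUid.
  case/lt_total/orP: (w_inj _ _ FS) => lt; first exact: IH.
  by rewrite addrC; apply: IH; rewrite 1?setUC //; apply: positionC.
rewrite !gvalS // 1?setUC // ltFS (lt_gtF ltFS) (availableC S).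
have av_neq0 := position_available _ _ _ pos UT.
rewrite [X in seqmin _ X](_ : _ =
  [seq 1 - x | x <- [seq gval e w n (v |: F) S | v <- enum (available e F S)]]).
  rewrite (seqmin_compl _ (wsum w F)) 1?addrC ?subrK //.
  by rewrite -size_eq0 size_map -cardE cards_eq0.
rewrite -map_comp; apply/eq_in_map => v; rewrite mem_enum => av /=.
by rewrite -(IHn _ _ (position_move1 _ _ _ _ av pos)) addrAC addrN add0r.
Qed.

(** Whatever is played, less than 1/3 is added to the side that is not ahead, so the gap stays below
    1/3. At the end the holdings sum to 1, which leaves 1st more than 1/3. *)
Lemma gval_ge_third n F S :
    (forall v, w v < 3^-1) -> position n F S ->
    `|wsum w F - wsum w S| < 3^-1 -> 3^-1 <= gval e w n F S.
Proof.
move=> w_lt; elim: n F S => [|n IHn] F S pos dFS.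
  have /(position_full _ _ _ pos) := position0 _ _ pos.
  by move: dFS; rewrite ltr_norml /=; lra.
have [UT|UT] := eqVneq (F :|: S) setT.
  rewrite gval_full //; have := position_full _ _ _ pos UT.
  by move: dFS; rewrite ltr_norml; lra.
have av0 := position_available _ _ _ pos UT.
rewrite gvalS //; case: ltP => [ltFS|leSF].
- have [v av ->] :=
    seqmax_attained _ (fun v => gval e w n (v |: F) S) (wsum w F) av0.
  apply: IHn; first exact: position_move1.
  have [vF vS] := available_notin _ _ _ av; rewrite wsumU1 //.
  by have := w_lt v; have := w_gt0 v; move: dFS; rewrite !ltr_norml; lra.
- have [v av ->] :=
    seqmin_attained _ (fun v => gval e w n F (v |: S)) (wsum w F) av0.
  apply: IHn; first exact: position_move2.
  have [vF vS] := available_notin _ _ _ av; rewrite wsumU1 //.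
  by have := w_lt v; have := w_gt0 v; move: dFS; rewrite !ltr_norml; lra.
Qed.

Lemma gval_ge_held n F S : position n F S -> wsum w F <= gval e w n F S.
Proof.
elim: n F S => [|n IHn] F S pos //.
have [UT|UT] := eqVneq (F :|: S) setT; first by rewrite gval_full.
have av0 := position_available _ _ _ pos UT; rewrite gvalS //; case: ltP => _.
- have [v av ->] :=
    seqmax_attained _ (fun v => gval e w n (v |: F) S) (wsum w F) av0.
  apply: le_trans (IHn _ _ (position_move1 _ _ _ _ av pos)).
  have [vF _] := available_notin _ _ _ av.
  by rewrite wsumU1 // lerDr ltW.
- have [v av ->] :=
    seqmin_attained _ (fun v => gval e w n F (v |: S)) (wsum w F) av0.
  exact: IHn _ _ (position_move2 _ _ _ _ av pos).
Qed.

Lemma first_value_le_game_value a : first_value e w a <= game_value e w.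
Proof. by apply: seqmax_ge; apply: map_f; rewrite mem_enum. Qed.

Lemma instance_inhabited : exists a : T, true.
Proof.
have [a|T0] := pickP (fun _ : T => true); first by exists a.
by have := oner_neq0 R; rewrite -wT /wsum big_pred0 ?eqxx // => a; have := T0 a.
Qed.

Lemma game_value_ge_third : 3^-1 <= game_value e w.
Proof.
have [/existsP[a wa]|/existsPn w_lt] := boolP [exists v, 3^-1 <= w v].
  apply: le_trans (first_value_le_game_value a).
  by apply: le_trans wa _; rewrite -wsum1; apply/gval_ge_held/position_start.
have [a _] := instance_inhabited.
apply: le_trans (first_value_le_game_value a).
have w_lt3 v : w v < 3^-1 by rewrite ltNge w_lt.
apply: gval_ge_third (position_start a) _ => //.
by rewrite wsum1 wsum0 subr0 gtr0_norm.
Qed.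

Lemma good_reply a : first_value e w a < 2^-1 ->
  exists v, e a v && (gval e w #|T|.-1 [set a] [set v] < 2^-1).
Proof.
have pos := position_start a; move: pos; rewrite /first_value.
have : (0 < #|T|)%N by apply/card_gt0P; exists a.
(* If [a] is the only vertex, 1st holds the whole weight 1, contrary to the assumed value below
   1/2. *)
case: #|T| => // n _ pos; have [UT|UT] := eqVneq ([set a] :|: set0) setT.
  by have := position_full _ _ _ pos UT; rewrite gval_full // wsum0; lra.
rewrite gvalS // wsum0 wsum1 (lt_gtF (w_gt0 a)).
have av0 := position_available _ _ _ pos UT.
have [v av ->] :=
  seqmin_attained _ (fun v => gval e w n [set a] (v |: set0)) (w a) av0.
rewrite setU0 => lt2; exists v; rewrite lt2 andbT.
move: av; rewrite inE => /andP[_ /existsP[u]].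
by rewrite setU0 inE => /andP[/eqP->].
Qed.

Lemma tree_game_value_ge_half : is_tree e -> 2^-1 <= game_value e w.
Proof.
case=> _ e_acyclic; rewrite leNgt; apply/negP => value_lt.
have [r rP] := fin_all_exists (fun a =>
  good_reply a (le_lt_trans (first_value_le_game_value a) value_lt)).
have [a0 _] := instance_inhabited.
have [|a ra] := acyclic_selfmap_two_cycle e r a0 e_irr e_acyclic.
  by move=> a; case/andP: (rP a).
have /andP[ea lt1] := rP a; have /andP[_ lt2] := rP (r a).
rewrite ra in lt2.
suff /gval_compl : position #|T|.-1 [set a] [set r a] by lra.
have := position_start a.
rewrite -(prednK (n := #|T|)); last by apply/card_gt0P; exists a.
move=> pos; have := position_move2 _ _ _ (r a) _ pos.
rewrite setU0; apply; rewrite !inE orbF; apply/andP; split.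
  by apply: contraTneq ea => ->; apply: e_irr.
by apply/existsP; exists a; rewrite !inE eqxx.
Qed.

End Game.

(** * Trees of value close to one half *)

Section TwoVertexTree.
Context {R : realType}.
Variables (d : R) (d_gt0 : 0 < d) (d_le : d <= 4^-1).

Definition edge_rel : rel bool := fun x y => x != y.
Definition edge_weight (b : bool) : R := if b then 2^-1 + d else 2^-1 - d.

Lemma edge_wsum A :
  wsum edge_weight A = (true \in A)%:R * (2^-1 + d) + (false \in A)%:R * (2^-1 - d).
Proof.
by rewrite /wsum big_mkcond big_bool /=; do 2 case: ifP => _; rewrite ?mul1r ?mul0r.
Qed.

(** The subset sums 0, 1/2 - d, 1/2 + d and 1 are distinct because 0 < d < 1/2. *)
Lemma edge_instance : is_instance edge_rel edge_weight.
Proof.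
split; [|split; [|split; [|split; [|split]]]].
- by move=> x y; rewrite /edge_rel eq_sym.
- by move=> x; rewrite /edge_rel eqxx.
- by move=> x y; have [->//|neq_xy] := eqVneq x y; apply: connect1.
- by move=> v; move: d_gt0 d_le; case: v => /= *; apply/andP; split; lra.
- by rewrite edge_wsum !inE /= !mul1r; lra.
move=> A B; apply: contraNneq; rewrite !edge_wsum => eqAB.
suff eq_mem: (true \in A) = (true \in B) /\ (false \in A) = (false \in B).
  by case: eq_mem => eqt eqf; apply/eqP/setP => -[].
by move: eqAB d_gt0 d_le; do 4 case: (_ \in _) => /=; rewrite ?mul1r ?mul0r; lra.
Qed.

Lemma edge_tree : is_tree edge_rel.
Proof.
split=> [x y|[x [p [_ uniq_p size_p _]]]].
  by have [->//|neq_xy] := eqVneq x y; apply: connect1.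
have := max_card (mem (x :: p)); rewrite card_bool (card_uniqP uniq_p) /=.
by rewrite leqNgt ltnS size_p.
Qed.

(** After the start 2nd is behind and takes the other vertex, so 1st keeps a single vertex, at best
    the heavier one. *)
Lemma edge_value_le : game_value edge_rel edge_weight <= 2^-1 + d.
Proof.
apply: seqmax_le_bound => [|_ /mapP[a _ ->]]; first by move: d_gt0; lra.
have U2 : [set a] :|: (~~ a |: set0) = setT by apply/setP; case: a; case; rewrite !inE.
have neqT : [set a] :|: set0 != setT.
  by rewrite setU0; apply/eqP => /setP/(_ (~~ a)); rewrite !inE; case: a {U2}.
rewrite /first_value card_bool gvalS // wsum0 wsum1.
have -> : (edge_weight a < 0) = false by move: d_gt0 d_le; case: a {U2 neqT} => /=; lra.
apply: (@le_trans _ _ (gval edge_rel edge_weight 1 [set a] (~~ a |: set0))).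
  apply: seqmin_le; apply/mapP; exists (~~ a) => //.
  rewrite mem_enum !inE orbF; apply/andP; split; first by case: a {U2 neqT}.
  by apply/existsP; exists a; rewrite !inE eqxx; case: a {U2 neqT}.
by rewrite gval_full // wsum1; move: d_gt0; case: a {U2 neqT} => /=; lra.
Qed.

End TwoVertexTree.

(** * A computable model of the game on the 7-cycle *)

Definition cyc_adj (i j : nat) := (j == i.+1 %% 7)%N || (i == j.+1 %% 7)%N.
(* Vertex [i] of the 7-cycle weighs [heavy i * N + light i] for a large [N]; the
   light parts come from a computer search. *)
Definition heavy (i : nat) : nat := i \in [:: 1; 2; 6]%N.
Definition light (i : nat) : nat := nth 0%N [:: 45; 0; 4; 9; 25; 35; 47]%N i.

(** Filtering [iota 0 7] rather than [f] ignores order and repetitions, so lists behave as sets. *)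
Definition count_in (c : nat -> nat) (f : seq nat) :=
  sumn [seq c i | i <- iota 0 7 & i \in f].

(** The lexicographic order does not mention [N], so one computation serves all large [N]. *)
Definition lighter (f s : seq nat) :=
  (count_in heavy f < count_in heavy s)%N ||
  (count_in heavy f == count_in heavy s) && (count_in light f < count_in light s)%N.

Definition moves (f s : seq nat) :=
  [seq v <- iota 0 7 | (v \notin f ++ s) &&
     has (fun u => (u \in f ++ s) && cyc_adj u v) (iota 0 7)].

Definition full (f s : seq nat) := all (mem (f ++ s)) (iota 0 7).

(* Whether 2nd can hold 1st to at most one heavy vertex from the position where
   1st holds the list [f] and 2nd the list [s]. *)
Fixpoint one_heavy (n : nat) (f s : seq nat) : bool :=
  (count_in heavy f <= 1)%N &&
  if n is n'.+1 then
    full f s ||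
    if lighter f s then all (fun v => one_heavy n' (v :: f) s) (moves f s)
    else has (fun v => one_heavy n' f (v :: s)) (moves f s)
  else true.

Lemma one_heavy_start : all (fun a => one_heavy 7 [:: a] [::]) (iota 0 7).
Proof. by vm_compute. Qed.

Definition sublists (s : seq nat) :=
  foldr (fun x ss => ss ++ map (cons x) ss) [:: [::]] s.

Lemma filter_sublists (p : pred nat) s : filter p s \in sublists s.
Proof.
elim: s => //= x s IHs; rewrite mem_cat.
by case: (p x); rewrite ?IHs ?map_f ?orbT.
Qed.

(** The absence of ties in integer form. Each subset has a unique increasing list among the sublists
    of [iota 0 7], so equality of lists stands for equality of sets. *)
Lemma counts_inj : all (fun f => all (fun g =>
  (count_in heavy f == count_in heavy g) && (count_in light f == count_in light g)
    ==> (f == g)) (sublists (iota 0 7))) (sublists (iota 0 7)).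
Proof. by vm_compute. Qed.

(** * Transfer of the computation to real weights *)

Section SevenCycle.
Context {R : realType}.
(** 165 is the sum of all light parts, so one heavy unit outweighs them together. *)
Variables (N : nat) (N_large : (165 < N)%N).

Definition cyc_rel : rel 'I_7 := fun i j => cyc_adj i j.
Definition mass (i : nat) : nat := (heavy i * N + light i)%N.
Definition total : nat := (3 * N + 165)%N.
Definition cyc_weight (i : 'I_7) : R := (mass i)%:R / total%:R.

Definition set_of (f : seq nat) : {set 'I_7} := [set i | val i \in f].

Lemma set_of_cons (a : 'I_7) f : set_of (val a :: f) = a |: set_of f.
Proof. by apply/setP => i; rewrite !inE. Qed.

Lemma set_of_nil : set_of [::] = set0.
Proof. by apply/setP => i; rewrite !inE. Qed.

Lemma set_of_cat f s : set_of (f ++ s) = set_of f :|: set_of s.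
Proof. by apply/setP => i; rewrite !inE mem_cat. Qed.

Lemma set_of_filter (A : {set 'I_7}) :
  set_of [seq i <- iota 0 7 | inord i \in A] = A.
Proof.
by apply/setP => i; rewrite inE mem_filter mem_iota inord_val ltn_ord leq0n !andbT.
Qed.

Lemma total_gt0 : 0 < total%:R :> R.
Proof. by rewrite ltr0n addn_gt0 orbT. Qed.

Lemma count_inE c f : count_in c f = (\sum_(i in set_of f) c (val i))%N.
Proof.
rewrite /count_in sumnE big_map big_filter -[iota 0 7]/(index_iota 0 7).
by rewrite big_mkord; apply: eq_bigl => i; rewrite inE.
Qed.

Lemma cyc_wsum f :
  wsum cyc_weight (set_of f) = (count_in heavy f * N + count_in light f)%:R / total%:R.
Proof.
rewrite !count_inE /wsum -mulr_suml -natr_sum big_distrl -big_split.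
by [].
Qed.

Lemma light_le f : (count_in light f <= 165)%N.
Proof.
rewrite count_inE; apply: (@leq_trans (\sum_(i < 7) light i)).
  by rewrite [leqLHS]big_mkcond leq_sum // => i _; case: ifP.
by rewrite !big_ord_recl big_ord0.
Qed.

(** Light sums are at most 165 < [N], so they matter only when the heavy counts agree. *)
Lemma lighterE f s :
  lighter f s = (wsum cyc_weight (set_of f) < wsum cyc_weight (set_of s)).
Proof.
rewrite !cyc_wsum ltr_pM2r ?invr_gt0 ?total_gt0 // ltr_nat /lighter.
have := light_le f; have := light_le s; move: N_large.
move: (count_in heavy f) (count_in heavy s) (count_in light f) (count_in light s).
move=> a b x y Nl yl xl; case: (ltngtP a b) => [ltab|ltba|->] /=.
- by apply/esym; nia.
- by apply/esym/negbTE; rewrite -leqNgt; nia.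
- by rewrite ltn_add2l.
Qed.

Lemma movesP f s (v : 'I_7) :
  (val v \in moves f s) = (v \in available cyc_rel (set_of f) (set_of s)).
Proof.
rewrite mem_filter mem_iota ltn_ord leq0n !andbT [in RHS]inE -set_of_cat inE.
congr (_ && _); apply/hasP/existsP => [[u]|[u]].
  rewrite mem_iota /= => ult /andP[uU uv]; exists (Ordinal ult).
  by rewrite inE /= uU.
by rewrite inE => /andP[uU uv]; exists (val u); rewrite ?mem_iota ?ltn_ord // uU.
Qed.

Lemma fullE f s : full f s = (set_of f :|: set_of s == setT).
Proof.
rewrite -set_of_cat; apply/allP/eqP => [allU|UT i].
  by apply/setP => i; rewrite !inE; apply: allU; rewrite mem_iota ltn_ord.
rewrite mem_iota /= => ilt; have /setP/(_ (Ordinal ilt)) := UT.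
by rewrite !inE.
Qed.

Lemma one_heavy_gval n f s : one_heavy n f s ->
  gval cyc_rel cyc_weight n (set_of f) (set_of s) <= (N + 165)%:R / total%:R.
Proof.
have leaf g : (count_in heavy g <= 1)%N ->
    wsum cyc_weight (set_of g) <= (N + 165)%:R / total%:R.
  move=> g1; rewrite cyc_wsum ler_pM2r ?invr_gt0 ?total_gt0 // ler_nat.
  by rewrite leq_add ?light_le // -[leqRHS]mul1n leq_mul2r g1 orbT.
elim: n f s => [|n IHn] f s /=; first by rewrite andbT; apply: leaf.
case/andP => f1; rewrite fullE; case: eqP => [_ _|_ /=]; first exact: leaf.
rewrite lighterE; case: ifP => _.
(* The default of [seqmax] has to be bounded as well, which is possible because [one_heavy] checks
   the heavy count at every position and not only at the end. *)
- move=> /allP all_moves; apply: seqmax_le_bound => [|_ /mapP[v av ->]].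
    exact: leaf.
  by rewrite -set_of_cons; apply/IHn/all_moves; rewrite movesP -mem_enum.
- move=> /hasP[v0 mv ok]; have v0lt: (v0 < 7)%N.
    by move: mv; rewrite mem_filter mem_iota => /andP[].
  pose v : 'I_7 := Ordinal v0lt.
  apply: le_trans (IHn _ _ ok); rewrite -[v0]/(val v) set_of_cons.
  by apply: seqmin_le; apply/mapP; exists v; rewrite // mem_enum -movesP.
Qed.

Lemma cyc_value_le :
  game_value cyc_rel cyc_weight <= (N + 165)%:R / total%:R.
Proof.
apply: seqmax_le_bound => [|_ /mapP[a _ ->]]; first by rewrite divr_ge0 ?ler0n.
have a7 : nat_of_ord a \in iota 0 7 by rewrite mem_iota ltn_ord.
have /one_heavy_gval := allP one_heavy_start _ a7.
by rewrite set_of_cons set_of_nil setU0 /first_value card_ord.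
Qed.

Lemma cyc_instance : is_instance cyc_rel cyc_weight.
Proof.
have cyc_sym : symmetric cyc_rel by move=> x y; rewrite /cyc_rel /cyc_adj orbC.
have wT : wsum cyc_weight setT = 1.
  have -> : setT = set_of (iota 0 7).
    by apply/setP => i; rewrite in_setT inE mem_iota ltn_ord.
  by rewrite cyc_wsum; apply/divff/lt0r_neq0/total_gt0.
have w_gt0 v : 0 < cyc_weight v.
  (* The only vertex with light part 0 is vertex 1, which is heavy. *)
  rewrite divr_gt0 ?total_gt0 // ltr0n /mass /heavy /light.
  by move: N_large; case: v => -[|[|[|[|[|[|[|]]]]]]] //= _; rewrite ?inE /=; lia.
split; [|split; [|split; [|split; [|split]]]] => //.
- by case=> -[|[|[|[|[|[|[|]]]]]]].
- have conn0 (x : 'I_7) : connect cyc_rel ord0 x.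
    case: x => x; elim: x => [|x IHx] lt7; first by apply: eq_connect0; apply: val_inj.
    apply: connect_trans (IHx (ltnW lt7)) (connect1 _).
    by rewrite /cyc_rel /cyc_adj /= modn_small ?eqxx.
  move=> x y; apply: connect_trans (conn0 y).
  by rewrite (sym_connect_sym cyc_sym).
- move=> v; rewrite w_gt0 -wT /wsum (bigD1 v) //= lerDl sumr_ge0 // => u _.
  exact: ltW.
(* Of two lists of equal weight neither is [lighter], so both of their counts agree and [counts_inj]
   applies. *)
move=> A B; apply: contraNneq; rewrite -[A]set_of_filter -[B]set_of_filter.
set f := filter _ _; set g := filter _ _ => /eqP eq_w; apply/eqP; congr set_of.
have key := allP (allP counts_inj f (filter_sublists _ _)) g (filter_sublists _ _).
apply/eqP/(implyP key); apply: contraT; rewrite negb_and => neq.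
have [lt_fg lt_gf] : ~~ lighter f g /\ ~~ lighter g f.
  by rewrite !lighterE (eqP eq_w) ltxx.
move: neq lt_fg lt_gf; rewrite /lighter.
by case: (ltngtP (count_in heavy f)) => //= _; case: ltngtP.
Qed.

End SevenCycle.

(* inf over all instances = 1/3 and inf over tree instances = 1/2, each
   stated as: lower bound + approximated to within any eps > 0. *)
Theorem theorem1 (R : realType) :
  [/\ (forall (T : finType) (e : rel T) (w : T -> R),
         is_instance e w -> 3^-1 <= game_value e w),
      (forall eps : R, 0 < eps ->
         exists (T : finType) (e : rel T) (w : T -> R),
           is_instance e w /\ game_value e w < 3^-1 + eps),
      (forall (T : finType) (e : rel T) (w : T -> R),
         is_instance e w -> is_tree e -> 2^-1 <= game_value e w)
    & (forall eps : R, 0 < eps ->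
         exists (T : finType) (e : rel T) (w : T -> R),
           [/\ is_instance e w, is_tree e & game_value e w < 2^-1 + eps])].
Proof.
split.
- by move=> T e w; apply: game_value_ge_third.
(* The bound (N + 165) / (3N + 165) exceeds 1/3 by 110 / (3N + 165), which is below 165 / N and
   hence below [eps]. The summand 166 ensures [N_large]. *)
- move=> eps eps_gt0; pose N := (166 + Num.Def.archi_bound (165 / eps))%N.
  have N_large : (165 < N)%N by rewrite leq_addr.
  exists 'I_7, cyc_rel, (cyc_weight N); split; first exact: cyc_instance.
  apply: le_lt_trans (cyc_value_le _ N_large) _.
  have : 165 / eps < N%:R.
    apply: lt_le_trans (archi_boundP _) _; first by rewrite divr_ge0 ?ltW.
    by rewrite ler_nat leq_addl.
  rewrite ltr_pdivrMr // ltr_pdivrMr ?total_gt0 // /total natrD natrD natrM.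
  by move: (N%:R) => x; nra.
- by move=> T e w; apply: tree_game_value_ge_half.
(* The bound 1/4 keeps both weights positive; halving [eps] makes the final inequality strict. *)
move=> eps eps_gt0; pose d : R := Num.min (4^-1) (eps / 2).
have d_gt0 : 0 < d by rewrite lt_min; apply/andP; split; lra.
have d_le : d <= 4^-1 by rewrite ge_min lexx.
exists bool, edge_rel, (edge_weight d); split.
- exact: edge_instance.
- exact: edge_tree.
apply: le_lt_trans (edge_value_le _ d_gt0 d_le) _.
have : d <= eps / 2 by rewrite ge_min lexx orbT.
by lra.
Qed.
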